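(* Consider the operators $\Delta=\partial_{xx}^2+\partial_{tt}^2$ and $H=\partial_{xx}^2-\partial_t$ on $[0,1]^2$, with coordinates $(x,t)$. For each $\varepsilon>0$ there exists a smooth real-valued function $u$ with $\Delta u\equiv 1$ on $[0,1]^2$ and $$|\{z\in[0,1]^2:|u(z)|\leq\varepsilon\}|\geq 1-\varepsilon.$$ Furthermore, for each $\varepsilon>0$ there exists a smooth real-valued function $u$ with $Hu\equiv 1$ on $[0,1]^2$ and $$|\{z\in[0,1]^2:|u(z)|\leq\varepsilon\}|\geq 1-\varepsilon.$$
   Context: $|\cdot|$ applied to a set denotes two-dimensional Lebesgue measure. ''Smooth'' on $[0,1]^2$ means smooth on an open neighbourhood of $[0,1]^2$. *)

(* Defs.v *)
From HB Require Import structures.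
From mathcomp Require Import all_boot all_order all_algebra.
From mathcomp Require Import all_classical all_reals all_analysis.
Import Order.TTheory GRing.Theory Num.Theory.
Import numFieldNormedType.Exports.

Set Implicit Arguments.
Unset Strict Implicit.
Unset Printing Implicit Defensive.

Local Open Scope classical_set_scope.
Local Open Scope ring_scope.

Section defs.
Context {R : realType}.
Implicit Types (u : R * R -> R) (U : set (R * R)) (z : R * R).

Definition unit_square : set (R * R) := `[0, 1] `*` `[0, 1].

Definition dx u : R * R -> R := fun z => derive1 (fun x : R => u (x, z.2)) z.1.
Definition dt u : R * R -> R := fun z => derive1 (fun t : R => u (z.1, t)) z.2.

(* [derive1] is total, so existence of the two partial derivatives is required
   separately. *)
Definition has_partials u z : Prop :=
  derivable (fun x : R => u (x, z.2)) z.1 1 /\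
  derivable (fun t : R => u (z.1, t)) z.2 1.

(* Class C^n on U; meaningful for U open, in which case only the values of u
   on U matter. *)
Fixpoint Cn_on (n : nat) U u : Prop :=
  (forall z, U z -> {for z, continuous u}) /\
  if n is m.+1 then
    [/\ forall z, U z -> has_partials u z, Cn_on m U (dx u) & Cn_on m U (dt u)]
  else True.

Definition smooth_on_open U u : Prop := open U /\ forall n, Cn_on n U u.

Definition smooth_on_square u : Prop :=
  exists2 U, unit_square `<=` U & smooth_on_open U u.

Definition laplacian u : R * R -> R := fun z => dx (dx u) z + dt (dt u) z.
Definition heat_op u : R * R -> R := fun z => dx (dx u) z - dt u z.

Definition lebesgue_measure2 : set (R * R) -> \bar R :=
  (@lebesgue_measure R \x @lebesgue_measure R)%E.

Definition sublevel_set u (eps : R) : set (R * R) :=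
  [set z | unit_square z /\ `|u z| <= eps].

End defs.

(* Main.v *)
(* On a fine grid, (x - k/n)^2 / 2 has Laplacian 1 and is tiny on the strip
   k/n <= x <= (k+1)/n, while - (t - k/n) has heat image 1 and is tiny on
   k/n <= t <= (k+1)/n.  Two such local solutions differ by an affine function of
   x (resp. by a constant), so they can be glued, up to a small error and off thin
   strips around the grid lines, with harmonic (resp. caloric) polynomials close
   to a step function.

   Harmonic case: with a = z - c + 1 and b = z - c - 1, the rational function
   a^N / (a^N + b^N) tends to the indicator function of Re z > c as N grows, and
   its poles lie on the line Re z = c.  Pushing them to infinity along that line,
   as in Runge's theorem, yields a polynomial in z = x + i t.

   Heat case: let f be the Bernstein polynomial of a step function.  Off the jump,
   f minus the step has exponentially small Taylor coefficients in a disc of fixed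
   radius r, hence the caloric polynomial sum_k f^(k)(t) x^(2k) / (2k)! is also
   close to the step, because k! / (2k)! <= exp(1/r) r^k. *)
Require Import Defs.
From HB Require Import structures.
From mathcomp Require Import all_boot all_order all_algebra.
From mathcomp Require Import all_classical all_reals all_analysis.
From mathcomp Require Import measurable_realfun complex zify ring lra.
Import Order.TTheory GRing.Theory Num.Theory.
Import numFieldNormedType.Exports.

Set Implicit Arguments.
Unset Strict Implicit.
Unset Printing Implicit Defensive.

Local Open Scope classical_set_scope.
Local Open Scope ring_scope.

(** * Bivariate polynomials *)

Section BivariatePolynomials.
Context {R : realType}.
Implicit Types p q : {poly {poly R}}.

(* The outer variable of [p] stands for x and the inner one for t. *)
Definition eval2 p (z : R * R) : R := p.[z.1%:P].[z.2].

Lemma eval2D p q z : eval2 (p + q) z = eval2 p z + eval2 q z.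
Proof. by rewrite /eval2 !hornerD. Qed.

Lemma eval2N p z : eval2 (- p) z = - eval2 p z.
Proof. by rewrite /eval2 !hornerN. Qed.

Lemma eval2M p q z : eval2 (p * q) z = eval2 p z * eval2 q z.
Proof. by rewrite /eval2 !hornerM. Qed.

Lemma eval2_sum I (r : seq I) (F : I -> {poly {poly R}}) z :
  eval2 (\sum_(i <- r) F i) z = \sum_(i <- r) eval2 (F i) z.
Proof. by rewrite /eval2 !horner_sum. Qed.

Lemma eval2X z : eval2 'X z = z.1.
Proof. by rewrite /eval2 hornerX hornerC. Qed.

Lemma eval2C (c : {poly R}) z : eval2 c%:P z = c.[z.2].
Proof. by rewrite /eval2 hornerC. Qed.

(** Freezing t first turns [p] into a one-variable polynomial in x, to which the formal derivative
    and the derivability of polynomials apply. *)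
Lemma eval2_map p (z : R * R) : eval2 p z = (map_poly (horner_eval z.2) p).[z.1].
Proof.
rewrite /eval2 -[in RHS](hornerC z.1 z.2).
exact: (esym (horner_map (horner_eval z.2) p z.1%:P)).
Qed.

(** The derivative in t acts on the coefficients; the ordinary formal derivative of the outer
    polynomial is the one in x. *)
Definition deriv2 p : {poly {poly R}} := map_poly (@deriv R) p.

Lemma deriv2D p q : deriv2 (p + q) = deriv2 p + deriv2 q.
Proof. exact: raddfD. Qed.

Lemma deriv2N p : deriv2 (- p) = - deriv2 p.
Proof. exact: raddfN. Qed.

Lemma deriv2C c : deriv2 c%:P = c^`()%:P.
Proof. by rewrite /deriv2 map_polyC. Qed.

Lemma deriv2M p q : deriv2 (p * q) = deriv2 p * q + p * deriv2 q.
Proof.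
apply/polyP => i; rewrite coefD coef_map/= !coefM raddf_sum/= -big_split/=.
by apply: eq_bigr => j _; rewrite derivM !coef_map.
Qed.

Lemma deriv2X : deriv2 'X = 0.
Proof. by apply/polyP => i; rewrite coef_map/= coefX coef0 -(derivC ((i == 1%N)%:R)) polyC_natr. Qed.

Lemma deriv2Xn n : deriv2 'X^n = 0.
Proof.
elim: n => [|n IH]; first by rewrite expr0 -polyC1 deriv2C derivC.
by rewrite exprS deriv2M deriv2X IH mul0r mulr0 addr0.
Qed.

Lemma horner_deriv2 p (x : R) : (p.[x%:P])^`() = (deriv2 p).[x%:P].
Proof.
elim/poly_ind: p => [|p c IH]; first by rewrite /deriv2 map_poly0 !horner0 deriv0.
rewrite deriv2D deriv2M deriv2X mulr0 addr0 deriv2C !hornerMXaddC.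
by rewrite derivD derivM derivC mulr0 addr0 IH.
Qed.

Lemma deriv_deriv2 p : (deriv2 p)^`() = deriv2 p^`().
Proof.
by apply/polyP => i; rewrite coef_deriv !coef_map/= coef_deriv derivMn.
Qed.

Lemma dx_eval2 p : dx (eval2 p) = eval2 p^`().
Proof.
apply/funext => z; rewrite /dx.
have -> : (fun x : R => eval2 p (x, z.2)) = horner (map_poly (horner_eval z.2) p).
  by apply/funext => x; rewrite eval2_map.
by rewrite -derivE deriv_map eval2_map.
Qed.

Lemma dt_eval2 p : dt (eval2 p) = eval2 (deriv2 p).
Proof.
apply/funext => z; rewrite /dt /eval2.
have -> : (fun t : R => p.[(z.1, t).1%:P].[(z.1, t).2]) = horner p.[z.1%:P] by [].
by rewrite -derivE horner_deriv2.
Qed.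

Lemma has_partials_eval2 p z : has_partials (eval2 p) z.
Proof.
split; last first.
  have -> : (fun t : R => eval2 p (z.1, t)) = horner p.[z.1%:P] by [].
  exact: derivable_horner.
have -> : (fun x : R => eval2 p (x, z.2)) = horner (map_poly (horner_eval z.2) p).
  by apply/funext => x; rewrite eval2_map.
exact: derivable_horner.
Qed.

Lemma continuous_eval2 p : continuous (eval2 p).
Proof.
elim/poly_ind: p => [|p c IH] z.
  have -> : eval2 0 = cst 0 by apply/funext => w; rewrite /eval2 !horner0.
  exact: cvg_cst.
have -> : eval2 (p * 'X + c%:P) = (fun w => eval2 p w * w.1 + c.[w.2]).
  by apply/funext => w; rewrite eval2D eval2M eval2X eval2C.
apply: cvgD; first by apply: cvgM; [exact: IH | exact: cvg_fst].
apply: (@cvg_comp _ _ _ snd (horner c)); first exact: cvg_snd.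
exact: continuous_horner.
Qed.

Lemma measurable_eval2 p : measurable_fun setT (eval2 p).
Proof.
elim/poly_ind: p => [|p c IH].
  have -> : eval2 0 = cst 0 by apply/funext => w; rewrite /eval2 !horner0.
  exact: measurable_cst.
have -> : eval2 (p * 'X + c%:P) = (fun w => eval2 p w * w.1 + c.[w.2]).
  by apply/funext => w; rewrite eval2D eval2M eval2X eval2C.
apply: measurable_funD; first by apply: measurable_funM.
apply: (measurableT_comp (f := horner c)) => //.
by apply: continuous_measurable_fun => t; exact: continuous_horner.
Qed.

(** Both partial derivatives of a polynomial are polynomials again, so induction on the order closes
    up. *)
Lemma Cn_on_eval2 n p : Cn_on n setT (eval2 p).
Proof.
elim: n p => [|n IH] p /=; (split; first by move=> z _; exact: continuous_eval2) => //.
split; first by move=> z _; exact: has_partials_eval2.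
  by rewrite dx_eval2.
by rewrite dt_eval2.
Qed.

Lemma smooth_eval2 p : smooth_on_square (eval2 p).
Proof.
exists setT => //; split; first exact: openT.
by move=> n; exact: Cn_on_eval2.
Qed.

Lemma laplacian_eval2 p z :
  laplacian (eval2 p) z = eval2 (p^`()^`() + deriv2 (deriv2 p)) z.
Proof. by rewrite /laplacian !dx_eval2 !dt_eval2 eval2D. Qed.

Lemma heat_op_eval2 p z :
  heat_op (eval2 p) z = eval2 (p^`()^`() - deriv2 p) z.
Proof. by rewrite /heat_op !dx_eval2 dt_eval2 /eval2 !hornerE. Qed.

(** Horner's scheme: multiplying a + ib by x + it and adding a constant preserves the Cauchy-Riemann
    equations. These are stated formally, so that harmonicity of [a] becomes an identity between
    polynomials. *)
Lemma complex_poly_parts (P : {poly R[i]}) :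
  exists a b : {poly {poly R}},
    [/\ a^`() = deriv2 b, deriv2 a = - b^`() &
     forall z, P.[(z.1 +i* z.2)%C] = (eval2 a z +i* eval2 b z)%C].
Proof.
elim/poly_ind: P => [|P c [a [b [ab ba Pab]]]].
  exists 0, 0; rewrite /deriv2 map_poly0 deriv0 oppr0; split => // z.
  by rewrite /eval2 !horner0.
exists (a * 'X - b * 'X%:P + (complex.Re c)%:P%:P),
       (b * 'X + a * 'X%:P + (complex.Im c)%:P%:P).
split.
- rewrite !deriv2D !deriv2M !deriv2C deriv2X !poly.derivE ab ba; ring.
- rewrite !deriv2D deriv2N !deriv2M !deriv2C deriv2X !poly.derivE ab ba; ring.
- move=> z; rewrite hornerMXaddC Pab !eval2D eval2N !eval2M !eval2X !eval2C !hornerE.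
  by case: c => c d /=; congr (_ +i* _)%C; ring.
Qed.

End BivariatePolynomials.

(** * Runge approximation of a step function *)

Import Normc.

(** * Moduli of complex numbers, as reals *)

Section ComplexNorm.
Context {R : realType}.
Implicit Types z w : R[i].

(** The norm of [R[i]] takes values in [R[i]]; this bridge transfers its properties to [normc],
    whose values lie in the ordered field [R]. *)
Lemma norm_normcE z : `|z| = (normc z)%:C%C.
Proof. by case: z => a b; rewrite normc_def. Qed.

Lemma normc_ge0 z : 0 <= normc z.
Proof. by rewrite -(@lecR R) -norm_normcE normr_ge0. Qed.

Lemma normcD z w : normc (z + w) <= normc z + normc w.
Proof. by rewrite -(@lecR R) raddfD/= -!norm_normcE ler_normD. Qed.

Lemma normcN z : normc (- z) = normc z.
Proof. by apply: (@complexI R); rewrite -!norm_normcE normrN. Qed.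

Lemma lerB_normc z w : normc z - normc w <= normc (z - w).
Proof. by rewrite lerBlDr -{1}(subrK w z) normcD. Qed.

Lemma normcX z n : normc (z ^+ n) = normc z ^+ n.
Proof. by elim: n => [|n IH]; rewrite ?expr0 ?normc1// !exprS normcM IH. Qed.

Lemma normc_sqr z : normc z ^+ 2 = complex.Re z ^+ 2 + complex.Im z ^+ 2.
Proof. by case: z => a b; rewrite /= sqr_sqrtr// addr_ge0// sqr_ge0. Qed.

Lemma Re_le_normc z : `|complex.Re z| <= normc z.
Proof. by rewrite -(@lecR R) -norm_normcE; exact: normc_ge_Re. Qed.

Lemma Im_le_normc z : `|complex.Im z| <= normc z.
Proof.
rewrite -(ler_pXn2r (ltn0Sn 1)) ?nnegrE ?normc_ge0//.
by rewrite normc_sqr real_normK ?num_real// lerDr sqr_ge0.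
Qed.

Lemma normc_gt0 z : (0 < normc z) = (z != 0).
Proof.
rewrite lt_neqAle normc_ge0 andbT eq_sym; congr negb.
by apply/eqP/eqP => [/eq0_normc//|->]; rewrite normc0.
Qed.

Lemma sqr_normc_gt0 z : 0 < normc z ^+ 2 -> z != 0.
Proof. by apply: contraTneq => ->; rewrite normc0 expr0n ltxx. Qed.

Lemma normc_real (a : R) : normc a%:C%C = `|a|.
Proof. by rewrite /= expr0n addr0 sqrtr_sqr. Qed.

Lemma normc_sum n (F : 'I_n -> R[i]) :
  normc (\sum_(i < n) F i) <= \sum_(i < n) normc (F i).
Proof.
elim/big_rec2: _ => [|i y w _ IH]; first by rewrite normc0.
by rewrite (le_trans (normcD _ _))// lerD2l.
Qed.

Lemma normc_unit_square z :
  0 <= complex.Re z <= 1 -> 0 <= complex.Im z <= 1 -> normc z <= 2.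
Proof.
move=> /andP[x0 x1] /andP[y0 y1].
rewrite -(ler_pXn2r (ltn0Sn 1)) ?nnegrE ?normc_ge0//.
rewrite normc_sqr; nra.
Qed.

End ComplexNorm.

Lemma expr_small {R : realType} (q e : R) :
  0 <= q -> q < 1 -> 0 < e -> exists n, q ^+ n <= e.
Proof.
move=> q0 q1 e0; have : `|q| < 1 by rewrite ger0_norm.
move=> /(cvg_geometric 1)/cvgrPdist_le/(_ e e0)[n _ /(_ n (leqnn n))].
rewrite /geometric/= sub0r normrN mul1r ger0_norm ?exprn_ge0//.
by exists n.
Qed.

(** * Uniform approximation by complex polynomials on a bounded set *)

Section UniformApproximation.
Context {R : realType}.
Variables (K : R[i] -> Prop) (B : R).
Hypothesis K_bounded : forall z, K z -> normc z <= B.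
Implicit Types f g : R[i] -> R[i].

Definition approximable f := forall e : R, 0 < e ->
  exists P : {poly R[i]}, forall z, K z -> normc (f z - P.[z]) <= e.

Lemma approximable_poly (P : {poly R[i]}) : approximable (horner P).
Proof. by move=> e e0; exists P => z _; rewrite subrr normc0 ltW. Qed.

Lemma approximable_lim f :
    (forall e : R, 0 < e -> exists2 g, approximable g &
       forall z, K z -> normc (f z - g z) <= e) ->
  approximable f.
Proof.
move=> fg e e0; have e20 : 0 < e / 2 by lra.
have [g ag fge] := fg _ e20; have [P gP] := ag _ e20.
exists P => z Kz.
have -> : f z - P.[z] = (f z - g z) + (g z - P.[z]) by ring.
by have := normcD (f z - g z) (g z - P.[z]); have := fge _ Kz; have := gP _ Kz; lra.
Qed.

Lemma eq_approximable f g :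
  (forall z, K z -> f z = g z) -> approximable f -> approximable g.
Proof.
by move=> fg af e /af[P fP]; exists P => z Kz; rewrite -fg//; exact: fP.
Qed.

Lemma poly_bounded (P : {poly R[i]}) :
  exists2 M : R, 0 <= M & forall z, K z -> normc P.[z] <= M.
Proof.
elim/poly_ind: P => [|P c [M M0 PM]].
  by exists 0 => // z _; rewrite horner0 normc0.
exists (M * `|B| + normc c) => [|z Kz].
  by rewrite addr_ge0 ?mulr_ge0 ?normc_ge0.
rewrite hornerMXaddC (le_trans (normcD _ _))// lerD2r normcM.
by rewrite ler_pM ?normc_ge0 ?PM// (le_trans (K_bounded Kz))// ler_norm.
Qed.

Lemma approximable_bounded f : approximable f ->
  exists2 M : R, 0 < M & forall z, K z -> normc (f z) <= M.
Proof.
move=> /(_ 1 ltr01)[P fP]; have [M M0 PM] := poly_bounded P.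
exists (1 + M) => [|z Kz]; first lra.
rewrite -[f z](subrK P.[z]) (le_trans (normcD _ _))//.
by rewrite lerD ?fP ?PM.
Qed.

Lemma approximableD f g :
  approximable f -> approximable g -> approximable (fun z => f z + g z).
Proof.
move=> af ag e e0; have e20 : 0 < e / 2 by lra.
have [[P fP] [Q gQ]] := (af _ e20, ag _ e20).
exists (P + Q) => z Kz; rewrite hornerD.
have -> : f z + g z - (P.[z] + Q.[z]) = (f z - P.[z]) + (g z - Q.[z]) by ring.
by have := normcD (f z - P.[z]) (g z - Q.[z]); have := fP _ Kz; have := gQ _ Kz; lra.
Qed.

(** The tolerances are chosen in turn: [P] against a bound of [g], then [Q] against a bound of [P],
    which is known only once [P] is fixed. *)
Lemma approximableM f g :
  approximable f -> approximable g -> approximable (fun z => f z * g z).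
Proof.
move=> af ag e e0.
have [M M0 gM] := approximable_bounded ag.
have [P fP] := af _ (divr_gt0 e0 (mulr_gt0 (ltr0Sn R 1) M0)).
have [L L0 PL] := poly_bounded P.
(* The bound [L] may vanish, so the division is by [L + 1]. *)
have L1 : 0 < L + 1 by lra.
have [Q gQ] := ag _ (divr_gt0 e0 (mulr_gt0 (ltr0Sn R 1) L1)).
exists (P * Q) => z Kz; rewrite hornerM.
have -> : f z * g z - P.[z] * Q.[z] =
  (f z - P.[z]) * g z + P.[z] * (g z - Q.[z]) by ring.
rewrite (le_trans (normcD _ _))// !normcM.
have h1 : normc (f z - P.[z]) * normc (g z) <= e / (2 * M) * M.
  by rewrite ler_pM ?normc_ge0 ?fP ?gM.
have h2 : normc P.[z] * normc (g z - Q.[z]) <= (L + 1) * (e / (2 * (L + 1))).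
  by rewrite ler_pM ?normc_ge0 ?gQ//; have := PL _ Kz; lra.
apply: (le_trans (lerD h1 h2)); rewrite le_eqVlt; apply/orP; left; apply/eqP.
by field; rewrite ?gt_eqF//=; lra.
Qed.

Lemma approximableX f n :
  approximable f -> approximable (fun z => f z ^+ n).
Proof.
move=> af; elim: n => [|n IH].
  by apply: (@eq_approximable (horner 1)) => [z _|]; [rewrite hornerC | exact: approximable_poly].
apply: (@eq_approximable (fun z => f z * f z ^+ n)) => [z _|]; first by rewrite exprS.
exact: approximableM.
Qed.

Lemma approximable_sum n (f : nat -> R[i] -> R[i]) :
  (forall i, approximable (f i)) ->
  approximable (fun z => \sum_(i < n) f i z).
Proof.
move=> af; elim: n => [|n IH].
  by apply: (@eq_approximable (horner 0)) => [z _|]; [rewrite horner0 big_ord0 | exact: approximable_poly].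
apply: (@eq_approximable (fun z => \sum_(i < n) f i z + f n z)) => [z _|].
  by rewrite big_ord_recr.
exact: approximableD.
Qed.

(** The geometric series converges uniformly: its remainder g^n / (1 - g) has modulus at most 2 /
    2^n. *)
Lemma approximable_geometric g :
  approximable g -> (forall z, K z -> normc (g z) <= 2^-1) ->
  approximable (fun z => (1 - g z)^-1).
Proof.
move=> ag gle; apply: approximable_lim => e e0.
have [n ne] : exists n, 2^-1 ^+ n <= e / 2 by apply: expr_small; lra.
exists (fun z => \sum_(i < n) g z ^+ i).
  by apply: (@approximable_sum n (fun i z => g z ^+ i)) => i; exact: approximableX.
move=> z Kz; have gz := gle _ Kz.
have g1 : 2^-1 <= normc (1 - g z).
  by have := lerB_normc 1 (g z); rewrite normc1; lra.
have ne0 : 1 - g z != 0 by rewrite -normc_gt0; lra.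
have -> : (1 - g z)^-1 - \sum_(i < n) g z ^+ i = g z ^+ n * (1 - g z)^-1.
  apply: (mulfI ne0); rewrite mulrBr divff// [RHS]mulrCA divff// mulr1.
  by rewrite -[X in X * \sum_(_ < _) _]opprB mulNr -subrX1 opprB subKr.
have {}ne : 2^-1 ^+ n * 2 <= e by lra.
rewrite normcM normcX normcV (le_trans _ ne)// ler_pM ?exprn_ge0 ?invr_ge0 ?normc_ge0//.
  by rewrite lerXn2r ?nnegrE ?normc_ge0//; lra.
by rewrite -[leRHS]invrK lef_pV2 ?posrE; lra.
Qed.

End UniformApproximation.

(** * Pole pushing and the holomorphic step *)

Section Strips.
Context {R : realType}.
Variables (c d : R).
Hypotheses (c0 : 0 <= c) (c1 : c <= 1) (d0 : 0 < d) (d1 : d <= 1).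

Definition off_strip (z : R[i]) : Prop :=
  [/\ 0 <= complex.Re z <= 1, 0 <= complex.Im z <= 1 & d <= `|complex.Re z - c|].

Lemma off_strip_bounded z : off_strip z -> normc z <= 2.
Proof. by case=> xI yI _; exact: normc_unit_square. Qed.

Notation approx := (approximable off_strip).

(** Expand 1 / (z - p) = - p^-1 / (1 - z / p) in powers of z / p, whose modulus is at most 2 / 4 on
    the domain. *)
Lemma approximable_pole_far (p : R[i]) : 4 <= normc p -> approx (fun z => (z - p)^-1).
Proof.
move=> p4; have p0 : p != 0 by rewrite -normc_gt0; lra.
have h : approx (fun z => (1 - (p^-1%:P * 'X).[z])^-1).
  apply: (approximable_geometric off_strip_bounded).
    exact: approximable_poly.
  move=> z /off_strip_bounded z2; rewrite hornerM hornerC hornerX normcM normcV.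
  by rewrite ler_pdivrMl; lra.
apply: (@eq_approximable _ _ (fun z => (- p^-1)%:P.[z] * (1 - (p^-1%:P * 'X).[z])^-1)).
  move=> z /off_strip_bounded z2; rewrite hornerM !hornerC hornerX.
  have zp : z - p != 0.
    by rewrite -normc_gt0 -normcN opprB; have := lerB_normc p z; lra.
  field; rewrite p0 zp/=.
  by rewrite -opprB oppr_eq0.
by apply: (approximableM off_strip_bounded) => //; exact: approximable_poly.
Qed.

(** Expand 1 / (z - p) in powers of (p - q) / (z - q). As [q] lies on the removed line, |z - q| >= d
    on the domain and the ratio is at most 1/2. *)
Lemma approximable_pole_step (p q : R[i]) :
  complex.Re q = c -> normc (p - q) <= d / 2 ->
  approx (fun z => (z - q)^-1) -> approx (fun z => (z - p)^-1).
Proof.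
move=> qc pq aq.
have zq z : off_strip z -> d <= normc (z - q).
  move=> [_ _ dz]; apply: (le_trans dz).
  by rewrite -qc -raddfB Re_le_normc.
have ag : approx (fun z => (p - q)%:P.[z] * (z - q)^-1).
  by apply: (approximableM off_strip_bounded) => //; exact: approximable_poly.
have gle z : off_strip z -> normc ((p - q)%:P.[z] * (z - q)^-1) <= 2^-1.
  move=> /zq dz; rewrite hornerC normcM normcV ler_pdivrMr; last exact: lt_le_trans dz.
  apply: (le_trans pq). lra.
apply: (@eq_approximable _ _ (fun z => (z - q)^-1 * (1 - (p - q)%:P.[z] * (z - q)^-1)^-1)).
  move=> z Kz; have dz := zq _ Kz; rewrite hornerC.
  have zq0 : z - q != 0 by rewrite -normc_gt0; exact: lt_le_trans dz.
  have -> : z - p = (z - q) * (1 - (p - q) * (z - q)^-1) by field.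
  by rewrite invfM.
apply: (approximableM off_strip_bounded) => //.
exact: (approximable_geometric off_strip_bounded).
Qed.

(* The pole is pushed down the line [Re z = c], in steps shorter than the
   distance to the domain, until it is far away. *)
Lemma approximable_pole (p : R[i]) :
  complex.Re p = c -> approx (fun z => (z - p)^-1).
Proof.
case: p => a s /= ->.
(* [n] moves of length d / 2 bring the imaginary part from [s] down to at most -4, where the modulus
   is at least 4. *)
have [n] : exists n : nat, s + 4 <= n%:R * (d / 2).
  exists (Num.truncn ((s + 4) / (d / 2))).+1.
  rewrite -ler_pdivrMr; last by have := d0; lra.
  by apply: ltW; exact: truncnS_gt.
elim: n s => [|n IH] s sn.
  apply: approximable_pole_far; apply: le_trans (Im_le_normc _) => /=.
  by move: sn; rewrite mul0r => sn; rewrite ler0_norm; lra.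
apply: (@approximable_pole_step _ (c +i* (s - d / 2))%C) => //; last first.
  by apply: IH; move: sn; rewrite -natr1; lra.
have -> : ((c +i* s) - (c +i* (s - d / 2)) = (0 +i* (d / 2)))%C.
  by congr (_ +i* _)%C; ring.
by rewrite /= expr0n add0r sqrtr_sqr ger0_norm; have := d0; lra.
Qed.

Lemma approximable_prod_poles (r : seq R[i]) :
  (forall p, p \in r -> complex.Re p = c) ->
  approx (fun z => (\prod_(p <- r) (z - p))^-1).
Proof.
elim: r => [|p r IH] rc.
  apply: (@eq_approximable _ _ (horner 1)) => [z _|]; last exact: approximable_poly.
  by rewrite big_nil invr1 hornerC.
apply: (@eq_approximable _ _ (fun z => (z - p)^-1 * (\prod_(p <- r) (z - p))^-1)).
  by move=> z _; rewrite big_cons invfM.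
apply: (approximableM off_strip_bounded).
  by apply: approximable_pole; rewrite rc// mem_head.
by apply: IH => q qr; rewrite rc// in_cons qr orbT.
Qed.

Lemma approximable_inv (D : {poly R[i]}) :
  (forall p, root D p -> complex.Re p = c) ->
  approx (fun z => D.[z]^-1).
Proof.
move=> Dc; have [r Dr] := closed_field_poly_normal D.
(* The zero polynomial is excluded by the hypothesis, as it would have the root c + 1. *)
have [D0|D0] := eqVneq D 0.
  have := Dc (c + 1)%:C%C; rewrite D0 root0 => /(_ isT) /=.
  by move/eqP; rewrite -subr_eq0 addrAC subrr add0r oner_eq0.
apply: (@eq_approximable _ _ (fun z => (lead_coef D)^-1%:P.[z] * (\prod_(p <- r) (z - p))^-1)).
  move=> z _; rewrite {2}Dr hornerZ invfM hornerC horner_prod.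
  congr (_ * _^-1).
  by apply: eq_bigr => p _; rewrite hornerXsubC.
apply: (approximableM off_strip_bounded); first exact: approximable_poly.
apply: approximable_prod_poles => p pr; apply: Dc.
by rewrite Dr rootZ ?lead_coef_eq0// root_prod_XsubC.
Qed.

Lemma le_normc_addr (u v : R[i]) (r : R) : r <= 2^-1 ->
  normc v <= r * normc u -> normc u <= 2 * normc (u + v).
Proof.
move=> r2 vu; have := lerB_normc u (- v); rewrite opprK normcN.
have : r * normc u <= 2^-1 * normc u by rewrite ler_wpM2r ?normc_ge0.
lra.
Qed.

Lemma addr_neq0_normc (u v : R[i]) (r : R) : u != 0 -> r <= 2^-1 ->
  normc v <= r * normc u -> u + v != 0.
Proof.
rewrite -!normc_gt0 => u0 r2 vu; have := le_normc_addr r2 vu; lra.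
Qed.

(** Since |u + v| >= |u| - |v| >= |u| / 2. With [u] and [v] the larger and the smaller of a^N and
    b^N, the fraction is the error of the rational step function. *)
Lemma normc_frac_le (u v : R[i]) (r : R) : u != 0 -> r <= 2^-1 ->
  normc v <= r * normc u -> normc (v / (u + v)) <= 2 * r.
Proof.
move=> u0 r2 vu; have uv := le_normc_addr r2 vu.
have := addr_neq0_normc u0 r2 vu; rewrite -normc_gt0 => uv0.
have r0 : 0 <= r.
  by rewrite -(@pmulr_lge0 _ (normc u)) ?normc_gt0// (le_trans _ vu)// normc_ge0.
rewrite normcM normcV ler_pdivrMr//; apply: (le_trans vu).
by rewrite (mulrC 2) -mulrA ler_wpM2l.
Qed.

(** Here [s] is the distance to the line. The two squared moduli differ by 4s >= 4d, and the larger
    one is at most 5. *)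
Lemma step_ratio (s y : R) : d <= s <= 1 -> 0 <= y <= 1 ->
  0 < (s + 1) ^+ 2 + y ^+ 2 /\
  (s - 1) ^+ 2 + y ^+ 2 <= (1 - 4 * d / 5) * ((s + 1) ^+ 2 + y ^+ 2).
Proof.
have := d0 => d_gt0 /andP[ds s1] /andP[y0 y1].
have y2 : y ^+ 2 <= 1 by rewrite expr_le1.
have s2 : (s + 1) ^+ 2 <= 4 by nra.
have y20 := sqr_ge0 y; have s20 : 1 <= (s + 1) ^+ 2 by nra.
split; first lra.
have : d * ((s + 1) ^+ 2 + y ^+ 2) <= d * 5 by rewrite ler_wpM2l; lra.
have -> : (s - 1) ^+ 2 = (s + 1) ^+ 2 - 4 * s by ring.
lra.
Qed.

Lemma complex_step (e : R) : 0 < e ->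
  exists P : {poly R[i]}, forall z, off_strip z ->
    normc (P.[z] - (c <= complex.Re z)%R%:R) <= e.
Proof.
move=> e0.
pose a : {poly R[i]} := 'X - (c - 1)%:C%C%:P.
pose b : {poly R[i]} := 'X - (c + 1)%:C%C%:P.
pose rho : R := 1 - 4 * d / 5.
have aE z : normc a.[z] ^+ 2 = (complex.Re z - c + 1) ^+ 2 + complex.Im z ^+ 2.
  rewrite /a hornerXsubC normc_sqr; case: z => x y /=; ring.
have bE z : normc b.[z] ^+ 2 = (complex.Re z - c - 1) ^+ 2 + complex.Im z ^+ 2.
  rewrite /b hornerXsubC normc_sqr; case: z => x y /=; ring.
have [m rm] : exists m, rho ^+ m <= Num.min 2^-1 (e / 4).
  by apply: expr_small; rewrite /rho ?lt_min; have := d0; have := d1; lra.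
have {rm}[rm2 rme] : rho ^+ m <= 2^-1 /\ rho ^+ m <= e / 4.
  by move: rm; rewrite le_min => /andP.
(* The case m = 0 would give 1 <= 1/2. The exponent is taken even because moduli are compared
   through their squares. *)
have m0 : (0 < 2 * m)%N.
  by case: m rm2 {rme} => //; rewrite expr0 => h; exfalso; lra.
pose N := (2 * m)%N.
(* At a root |a|^N = |b|^N, so the root is equidistant from c - 1 and c + 1 and lies on their
   bisector. *)
have Dc p : root (a ^+ N + b ^+ N) p -> complex.Re p = c.
  rewrite /root hornerD !horner_exp addr_eq0 => /eqP/(congr1 (@normc R)).
  rewrite normcN !normcX => /eqP; rewrite eqrXn2 ?normc_ge0// => /eqP h.
  by have := congr1 (fun x => x ^+ 2) h; rewrite aE bE; lra.
have fa : approx (fun z => (a ^+ N).[z] * (a ^+ N + b ^+ N).[z]^-1).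
  apply: (approximableM off_strip_bounded); first exact: approximable_poly.
  exact: approximable_inv.
have e20 : 0 < e / 2 by lra.
have [P fP] := fa _ e20; exists P => z Kz.
have := fP _ Kz; rewrite -normcN opprB => {}fP.
set f := (a ^+ N).[z] * _ in fP.
have -> : P.[z] - (c <= complex.Re z)%R%:R = P.[z] - f + (f - (c <= complex.Re z)%R%:R) by ring.
rewrite (le_trans (normcD _ _))// [leRHS]splitr lerD// /f hornerD !horner_exp.
have powle (u v : R[i]) : normc v ^+ 2 <= rho * normc u ^+ 2 ->
    normc (v ^+ N) <= rho ^+ m * normc (u ^+ N).
  move=> vu; rewrite !normcX /N !exprM -exprMn.
  apply: lerXn2r => //; rewrite nnegrE ?exprn_ge0 ?normc_ge0//.
  rewrite mulr_ge0 ?exprn_ge0 ?normc_ge0// /rho.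
  by have := d0; have := d1; lra.
have e4 : 2 * rho ^+ m <= e / 2 by lra.
apply: le_trans e4.
case: Kz => /andP[x0 x1] yI dx.
(* To the right of the line b^N is the small term, and 1 minus the quotient is b^N / (a^N + b^N). To
   the left, reflection in the line exchanges [a] and [b], and the quotient itself is small. *)
case: (leP c (complex.Re z)) => xc.
- have dx' : d <= complex.Re z - c <= 1.
    by move: dx; rewrite ger0_norm ?subr_ge0// => ->/=; have := c0; lra.
  have [a0 ab] := step_ratio dx' yI; rewrite -aE -bE in a0 ab.
  have {}a0 : a.[z] ^+ N != 0 by rewrite expf_neq0// sqr_normc_gt0.
  have h := normc_frac_le a0 rm2 (powle _ _ ab).
  have ab0 := addr_neq0_normc a0 rm2 (powle _ _ ab).
  rewrite -normcN opprB.
  have -> : true%:R - a.[z] ^+ N * (a.[z] ^+ N + b.[z] ^+ N)^-1 =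
    b.[z] ^+ N / (a.[z] ^+ N + b.[z] ^+ N) by rewrite (_ : true%:R = 1)//; field.
  exact: h.
- have dx' : d <= - (complex.Re z - c) <= 1.
    by move: dx; rewrite ltr0_norm ?subr_lt0// => ->/=; have := c1; lra.
  have [b0 ba] := step_ratio dx' yI.
  have bE' : normc b.[z] ^+ 2 = (- (complex.Re z - c) + 1) ^+ 2 + complex.Im z ^+ 2.
    by rewrite bE; ring.
  have aE' : normc a.[z] ^+ 2 = (- (complex.Re z - c) - 1) ^+ 2 + complex.Im z ^+ 2.
    by rewrite aE; ring.
  rewrite -aE' -bE' in b0 ba.
  have {}b0 : b.[z] ^+ N != 0 by rewrite expf_neq0// sqr_normc_gt0.
  by rewrite subr0 addrC; apply: normc_frac_le => //; exact: powle.
Qed.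
End Strips.

(** * Caloric approximation of a step function *)

Section WeightedNorm.
Context {R : realFieldType}.
Implicit Types (p q : {poly R}) (r : R).

(** The sum of |p_i| r^i, which controls all Taylor coefficients at once. Writing it as a value of a
    polynomial reduces its inequalities to coefficientwise ones. *)
Definition wnorm r p : R := (map_poly Num.norm p).[r].

Lemma coef_normp p i : (map_poly Num.norm p)`_i = `|p`_i|.
Proof. by rewrite coef_map_id0// normr0. Qed.

Lemma ler_horner_coef r p q :
  0 <= r -> (forall i, p`_i <= q`_i) -> p.[r] <= q.[r].
Proof.
move=> r0 pq; rewrite (horner_coef_wide _ (leq_maxl (size p) (size q))).
rewrite (horner_coef_wide _ (leq_maxr (size p) (size q))).
by apply: ler_sum => i _; rewrite ler_wpM2r ?exprn_ge0.
Qed.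

Lemma wnormE n r p : (size p <= n)%N -> wnorm r p = \sum_(i < n) `|p`_i| * r ^+ i.
Proof.
move=> pn; rewrite /wnorm (@horner_coef_wide _ n) ?(leq_trans (size_poly _ _))//.
by apply: eq_bigr => i _; rewrite coef_normp.
Qed.

Lemma wnorm_ge0 r p : 0 <= r -> 0 <= wnorm r p.
Proof.
by move=> r0; rewrite (wnormE _ (leqnn _)) sumr_ge0// => i _; rewrite mulr_ge0 ?exprn_ge0.
Qed.

Lemma wnormC r (c : R) : wnorm r c%:P = `|c|.
Proof. by rewrite (wnormE _ (size_polyC_leq1 c)) big_ord1 coefC mulr1. Qed.

Lemma wnorm_polyX r : wnorm r 'X = r.
Proof.
rewrite (@wnormE 2) ?size_polyX// big_ord_recl big_ord1 !coefX/=.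
by rewrite normr0 normr1 mul0r add0r mul1r.
Qed.

Lemma wnormD r p q : 0 <= r -> wnorm r (p + q) <= wnorm r p + wnorm r q.
Proof.
move=> r0; rewrite /wnorm -hornerD; apply: ler_horner_coef => // i.
by rewrite coefD !coef_normp coefD ler_normD.
Qed.

Lemma wnormM r p q : 0 <= r -> wnorm r (p * q) <= wnorm r p * wnorm r q.
Proof.
move=> r0; rewrite /wnorm -hornerM; apply: ler_horner_coef => // i.
rewrite coef_normp !coefM (le_trans (ler_norm_sum _ _ _))//.
by apply: ler_sum => j _; rewrite normrM !coef_normp.
Qed.

Lemma wnormX r p n : 0 <= r -> wnorm r (p ^+ n) <= wnorm r p ^+ n.
Proof.
move=> r0; elim: n => [|n IH]; first by rewrite !expr0 -polyC1 wnormC normr1.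
by rewrite !exprS (le_trans (wnormM _ _ r0))// ler_wpM2l// wnorm_ge0.
Qed.

Lemma wnormMn r p n : 0 <= r -> wnorm r (p *+ n) <= wnorm r p *+ n.
Proof.
move=> r0; elim: n => [|n IH]; first by rewrite !mulr0n -polyC0 wnormC normr0.
by rewrite !mulrS (le_trans (wnormD _ _ r0))// lerD2l.
Qed.

Lemma wnorm_sum r I (s : seq I) (P : pred I) (F : I -> {poly R}) : 0 <= r ->
  wnorm r (\sum_(i <- s | P i) F i) <= \sum_(i <- s | P i) wnorm r (F i).
Proof.
move=> r0; elim/big_rec2: _ => [|i y p _ IH].
  by rewrite -polyC0 wnormC normr0.
by rewrite (le_trans (wnormD _ _ r0))// lerD2l.
Qed.

End WeightedNorm.

(** * Taylor coefficients of the Bernstein polynomials of a step *)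

Section BernsteinStep.
Context {R : realFieldType}.

(* The Bernstein polynomial of degree [2m] of the step at [c], on the interval
   from [c - 1] to [c + 1]. *)
Definition bstep (c : R) (m : nat) : {poly R} :=
  let A := 2^-1%:P * ('X - c%:P) + 2^-1%:P in
  \sum_(i < (2 * m).+1 | (m <= i)%N) ((1 - A) ^+ (2 * m - i) * A ^+ i) *+ 'C(2 * m, i).

(** Each term kept by [P] is at most (ab)^m times its binomial coefficient, and the binomial
    coefficients of row 2m sum to 4^m. *)
Lemma bernstein_tail (A B : {poly R}) (P : pred nat) (r a b : R) m : 0 <= r ->
  wnorm r A <= a -> wnorm r B <= b ->
  (forall i, (i <= 2 * m)%N -> P i -> b ^+ (2 * m - i) * a ^+ i <= (a * b) ^+ m) ->
  wnorm r (\sum_(i < (2 * m).+1 | P i) (B ^+ (2 * m - i) * A ^+ i) *+ 'C(2 * m, i))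
    <= (4 * (a * b)) ^+ m.
Proof.
move=> r0 Aa Bb Pab.
have a0 : 0 <= a by apply: le_trans Aa; exact: wnorm_ge0.
have b0 : 0 <= b by apply: le_trans Bb; exact: wnorm_ge0.
have -> : (4 * (a * b)) ^+ m = \sum_(i < (2 * m).+1) (a * b) ^+ m *+ 'C(2 * m, i).
  rewrite exprMn (_ : 4 = (1 + 1) ^+ 2); last by ring.
  rewrite -exprM exprD1n mulr_suml; apply: eq_bigr => i _.
  by rewrite expr1n mulrnAl mul1r.
apply: (le_trans (wnorm_sum _ _ _ r0)).
rewrite [leRHS](bigID (fun i : 'I__ => P i))/= -[leLHS]addr0 lerD//; last first.
  by apply: sumr_ge0 => i _; rewrite mulrn_wge0// exprn_ge0// mulr_ge0.
apply: ler_sum => i Pi; apply: (le_trans (wnormMn _ _ r0)).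
rewrite lerMn2r; apply/orP; right.
apply: le_trans (Pab i _ Pi); last by rewrite -ltnS.
apply: (le_trans (wnormM _ _ r0)); rewrite ler_pM ?wnorm_ge0//.
  by rewrite (le_trans (wnormX _ _ r0))// lerXn2r ?nnegrE ?wnorm_ge0.
by rewrite (le_trans (wnormX _ _ r0))// lerXn2r ?nnegrE ?wnorm_ge0.
Qed.

(** Recentred at [t], the Bernstein variable is X / 2 + s, so it and its complement have norms at
    most [a] and [b]. As a + b = 1 + r and a - b = t - c, one gets 4ab = (1 + r)^2 - (t - c)^2. *)
Lemma wnorm_bstep (c t d r : R) m : 0 <= c <= 1 -> 0 <= t <= 1 ->
  0 <= r -> 0 <= d -> d <= `|t - c| ->
  wnorm r ((bstep c m \Po ('X + t%:P)) - ((c <= t)%R%:R)%:P)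
    <= ((1 + r) ^+ 2 - d ^+ 2) ^+ m.
Proof.
move=> cI tI r0 d0 dtc.
pose s := 2^-1 * (t - c) + 2^-1.
pose A : {poly R} := 2^-1%:P * 'X + s%:P.
pose a := r / 2 + s; pose b := r / 2 + (1 - s).
have s0 : 0 <= s by rewrite /s; lra.
have s1 : s <= 1 by rewrite /s; lra.
have AE : (2^-1%:P * ('X - c%:P) + 2^-1%:P) \Po ('X + t%:P) = A.
  rewrite comp_polyD comp_polyM comp_polyB !comp_polyC comp_polyX /A /s.
  rewrite polyCD polyCM polyCB; ring.
have Aa : wnorm r A <= a.
  rewrite /A /a (le_trans (wnormD _ _ r0))// wnormC (ger0_norm s0) lerD2r.
  by rewrite (le_trans (wnormM _ _ r0))// wnormC wnorm_polyX ger0_norm; lra.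
have Bb : wnorm r (1 - A) <= b.
  have -> : 1 - A = (- 2^-1)%:P * 'X + (1 - s)%:P.
    by rewrite /A polyCB polyCN; ring.
  rewrite /b (le_trans (wnormD _ _ r0))// wnormC (@ger0_norm _ (1 - s)) ?subr_ge0// lerD2r.
  by rewrite (le_trans (wnormM _ _ r0))// wnormC wnorm_polyX normrN ger0_norm; lra.
have a0 : 0 <= a by rewrite /a; lra.
have b0 : 0 <= b by rewrite /b; lra.
have ab : (4 * (a * b)) ^+ m <= ((1 + r) ^+ 2 - d ^+ 2) ^+ m.
  have -> : 4 * (a * b) = (1 + r) ^+ 2 - `|t - c| ^+ 2.
    by rewrite real_normK ?num_real// /a /b /s; field.
  have dt2 : d ^+ 2 <= `|t - c| ^+ 2 by rewrite lerXn2r ?nnegrE.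
  have t2 : `|t - c| ^+ 2 <= 1.
    by rewrite real_normK ?num_real//; nra.
  rewrite lerXn2r ?nnegrE//; nra.
apply: le_trans ab; clearbody A.
have fE : bstep c m \Po ('X + t%:P) =
  \sum_(i < (2 * m).+1 | (m <= i)%N) ((1 - A) ^+ (2 * m - i) * A ^+ i) *+ 'C(2 * m, i).
  rewrite /bstep raddf_sum/=; apply: eq_bigr => i _.
  by rewrite raddfMn/= rmorphM/= !rmorphXn/= rmorphB/= rmorph1 AE.
case: (leP c t) => ct.
(* For t >= c, subtracting 1 = ((1 - A) + A)^(2m) leaves minus the terms with i < m, which are small
   because a >= b. For t < c the terms with i >= m are already small, because a <= b. *)
- have f1 : (bstep c m \Po ('X + t%:P)) - (true%:R)%:P =
    - \sum_(i < (2 * m).+1 | ~~ (m <= i)%N) ((1 - A) ^+ (2 * m - i) * A ^+ i) *+ 'C(2 * m, i).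
    rewrite fE; have := exprDn (1 - A) A (2 * m); rewrite subrK expr1n.
    rewrite [RHS](bigID (fun i : 'I__ => (m <= i)%N))/= => E1.
    by rewrite (_ : true%:R%:P = 1)// [X in _ - X]E1 opprD addrA subrr add0r.
  rewrite f1 -mulN1r -polyCN (le_trans (wnormM _ _ r0))// wnormC normrN1 mul1r.
  apply: (bernstein_tail (P := fun i => ~~ (m <= i)%N)) => // i _.
  rewrite -ltnNge => im.
  have -> : (2 * m - i = m + (m - i))%N by clear -im; lia.
  have -> : (a * b) ^+ m = b ^+ m * (a ^+ (m - i) * a ^+ i).
    by rewrite -exprD subnK ?exprMn 1?mulrC// ltnW.
  rewrite exprD -mulrA ler_wpM2l ?exprn_ge0// ler_wpM2r ?exprn_ge0//.
  by rewrite lerXn2r ?nnegrE// /a /b /s; lra.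
- rewrite subr0 fE; apply: bernstein_tail => // i im mi.
  have -> : (a * b) ^+ m = b ^+ (2 * m - i) * (a ^+ m * b ^+ (i - m)).
    rewrite mulrCA -exprD exprMn; congr (_ * _ ^+ _).
    by clear -im mi; lia.
  rewrite ler_wpM2l ?exprn_ge0// -{1}(subnK mi) exprD mulrC ler_wpM2l ?exprn_ge0//.
  by rewrite lerXn2r ?nnegrE// /a /b /s; lra.
Qed.
End BernsteinStep.

(** * Caloric extension of a polynomial in t *)

Section HeatExtension.
Context {R : realType}.
Implicit Types f : {poly R}.

Lemma expr_fact_le_expR (a : R) k : 0 <= a -> a ^+ k / k`!%:R <= expR a.
Proof.
move=> a0; case: k => [|k].
  by rewrite expr0 fact0 divr1 -expR0 ler_expR.
by have := expR_ge1Dxn k a0; lra.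
Qed.

(** The quotient is the central binomial coefficient, which is positive. *)
Lemma leq_fact_sqr k : (k`! * k`! <= (2 * k)`!)%N.
Proof.
have k2 : (k <= 2 * k)%N by lia.
rewrite -(bin_fact k2) (_ : 2 * k - k = k)%N; last lia.
by rewrite leq_pmull// bin_gt0.
Qed.

(** By the previous bound k! / (2k)! <= 1 / k!, and (1/r)^k / k! is a term of the series of
    exp(1/r). *)
Lemma fact_ratio_le (r : R) k : 0 < r ->
  k`!%:R / (2 * k)`!%:R <= expR r^-1 * r ^+ k.
Proof.
move=> r0; rewrite -ler_pdivrMr ?exprn_gt0//.
have kf n : 0 < n`!%:R :> R by rewrite ltr0n fact_gt0.
apply: le_trans (expr_fact_le_expR k _); last by rewrite invr_ge0 ltW.
rewrite exprVn [leRHS]mulrC ler_pM2r ?invr_gt0 ?exprn_gt0//.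
rewrite -[leRHS]div1r ler_pdivlMr// mulrAC ler_pdivrMr// mul1r.
by rewrite -natrM ler_nat leq_fact_sqr.
Qed.

(* The caloric function with Cauchy data [u(0,t) = f t], [u_x(0,t) = 0]. *)
Definition caloric f : {poly {poly R}} :=
  \sum_(k < (size f).+1) ((2 * k)`!%:R^-1 *: f^`(k))%:P * 'X^(2 * k).

Lemma caloricP f : (caloric f)^`()^`() = deriv2 (caloric f).
Proof.
have -> : (caloric f)^`()^`() = \sum_(k < (size f).+1)
    (((2 * k)`!%:R^-1 *: f^`(k))%:P * 'X^(2 * k))^`()^`().
  by rewrite /caloric !raddf_sum.
have -> : deriv2 (caloric f) = \sum_(k < (size f).+1)
    (((2 * k)`!%:R^-1 *: f^`(k.+1))%:P * 'X^(2 * k)).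
  rewrite /caloric /deriv2 raddf_sum; apply: eq_bigr => k _ /=.
  rewrite -/(deriv2 _) deriv2M deriv2C derivZ -derivnS.
  by rewrite deriv2Xn mulr0 addr0.
(* The x-derivatives kill the term k = 0, and the t-derivative kills the last one, where the order
   exceeds the degree; the rest match after shifting the index by one. *)
rewrite [LHS]big_ord_recl [RHS]big_ord_recr/= -?derivnS (derivn_poly0 (leqnSn _)).
rewrite scaler0 polyC0 mul0r addr0 muln0 expr0 mulr1 !derivC ?deriv0 ?derivC add0r.
apply: eq_bigr => k _; rewrite /bump/= add1n.
have -> : (2 * k.+1 = (2 * k).+2)%N by lia.
rewrite derivM derivC mul0r add0r derivXn derivM derivC mul0r add0r derivMn derivXn/=.
rewrite -mulrnA mulrnAr -mulrnAl -polyCMn scalerMnl.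
congr ((_ *: _)%:P * _).
have kf n : n`!%:R != 0 :> R by rewrite pnatr_eq0 -lt0n fact_gt0.
rewrite -mulr_natr; apply: (mulfI (kf (2 * k).+2)); rewrite mulrA divff// mul1r.
apply: (mulIf (kf (2 * k)%N)); rewrite -mulrA mulVf// mulr1 -natrM.
by congr _%:R; rewrite !factS; lia.
Qed.

Lemma coef_comp_shift f (t : R) i : (f \Po ('X + t%:P))`_i = f^`N(i).[t].
Proof.
have [n fn] : exists2 n, (size f <= n)%N & (i < n)%N.
  by exists (maxn (size f) i.+1); rewrite ?leq_maxl ?leq_maxr.
move=> ni; rewrite /comp_poly addrC (nderiv_taylor_wide (n := n)) ?size_map_polyC//; last exact: mulrC.
rewrite coef_sum (bigD1 (Ordinal ni))//= big1 => [|j ji].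
  rewrite nderivn_map horner_map coefCM coefXn eqxx mulr1 addr0.
  by [].
rewrite nderivn_map horner_map coefCM coefXn.
by rewrite eq_sym -val_eqE/= in ji *; rewrite (negbTE ji) mulr0.
Qed.

(** At (x, t) the extension is the sum of the Taylor coefficients of [f] at [t] with weights x^(2k)
    k! / (2k)!. The weight at k = 0 is 1, so [v] can be subtracted from that coefficient. *)
Lemma caloric_close f (v r x t : R) : 0 < r -> `|x| <= 1 ->
  `|eval2 (caloric f) (x, t) - v|
    <= expR r^-1 * wnorm r (f \Po ('X + t%:P) - v%:P).
Proof.
move=> r0 x1; set g := f \Po _ - _.
have gs : (size g <= (size f).+1)%N.
  rewrite /g (leq_trans (size_polyD _ _))// geq_max size_polyN.
  rewrite (leq_trans (size_polyC_leq1 _))// andbT.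
  rewrite (leq_trans (size_comp_poly_leq _ _))// size_XaddC.
  by rewrite muln1; lia.
have -> : eval2 (caloric f) (x, t) - v =
    \sum_(k < (size f).+1) g`_k * (k`!%:R / (2 * k)`!%:R) * x ^+ (2 * k).
  have gE k : g`_k = f^`N(k).[t] - (if k == 0 then v else 0).
    by rewrite /g coefB coefC coef_comp_shift.
  have fE k : f^`(k).[t] = f^`N(k).[t] * k`!%:R.
    by rewrite nderivn_def hornerMn mulr_natr.
  have cE k : eval2 (((2 * k)`!%:R^-1 *: f^`(k))%:P * 'X^(2 * k)) (x, t) =
      f^`N(k).[t] * (k`!%:R / (2 * k)`!%:R) * x ^+ (2 * k).
    rewrite /eval2 hornerM hornerC hornerXn hornerM -polyC_exp hornerC /= hornerZ fE.
    by congr (_ * _); rewrite mulrC mulrA.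
  rewrite /caloric eval2_sum big_ord_recl [in RHS]big_ord_recl/= cE gE eqxx.
  rewrite muln0 fact0 expr0 divr1 !mulr1 addrAC; congr (_ + _).
  by apply: eq_bigr => k _; rewrite cE gE subr0.
rewrite (wnormE _ gs) mulr_sumr (le_trans (ler_norm_sum _ _ _))//.
apply: ler_sum => k _; rewrite normrM normrM -mulrA [leRHS]mulrCA ler_wpM2l//.
rewrite -[leRHS]mulr1 ler_pM//.
  by rewrite ger0_norm ?fact_ratio_le// divr_ge0.
by rewrite normrX exprn_ile1.
Qed.

End HeatExtension.

Lemma caloric_step {R : realType} (c d e : R) :
  0 <= c <= 1 -> 0 < d -> d <= 1 -> 0 < e ->
  exists f : {poly R}, forall x t : R, 0 <= x <= 1 -> 0 <= t <= 1 ->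
    d <= `|t - c| ->
    `|eval2 (caloric f) (x, t) - (c <= t)%R%:R| <= e.
Proof.
(* With this radius (1 + r)^2 - d^2 = 1 - d^2 / 2 + d^4 / 16, which lies in [0, 1). *)
move=> cI d0 d1 e0; pose r := d ^+ 2 / 4.
have r0 : 0 < r by rewrite /r divr_gt0// exprn_gt0.
have d2 : d ^+ 2 <= 1 by rewrite expr_le1// ltW.
have d20 : 0 < d ^+ 2 by rewrite exprn_gt0.
have [m qm] : exists m, ((1 + r) ^+ 2 - d ^+ 2) ^+ m <= e / expR r^-1.
  by apply: expr_small; rewrite ?divr_gt0 ?expR_gt0// /r; nra.
exists (bstep c m) => x t /andP[x0 x1] tI dtc.
have x1' : `|x| <= 1 by rewrite ger0_norm.
apply: (le_trans (caloric_close _ _ _ r0 x1')).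
rewrite mulrC -ler_pdivlMr ?expR_gt0// (le_trans _ qm)//.
by apply: wnorm_bstep => //; exact: ltW.
Qed.

(** * Grid points, local indices and the measure of the removed strips *)

Section Grid.
Context {R : realType}.

(** The nodes are 1/n, ..., n/n: there is no jump at 0, where the first local solution starts. *)
Definition off_grid (n : nat) (d : R) : set R :=
  `[0, 1]%classic `\`
    \big[setU/set0]_(i < n) `](i.+1%:R / n%:R - d), (i.+1%:R / n%:R + d)[%classic.

Lemma off_gridP n d x : off_grid n d x ->
  0 <= x <= 1 /\ forall i : 'I_n, d <= `|x - i.+1%:R / n%:R|.
Proof.
rewrite /off_grid /= in_itv/= => -[xI nx]; split=> // i.
rewrite leNgt; apply/negP => xd; apply: nx.
rewrite -(bigcup_mkord n (fun i => `](i.+1%:R / n%:R - d), (i.+1%:R / n%:R + d)[%classic)).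
by exists i => //=; move: xd; rewrite in_itv/= ltr_norml; lra.
Qed.

Lemma measurable_off_grid n d : measurable (off_grid n d).
Proof.
apply: measurableD => //; apply: bigsetU_measurable => i _.
exact: measurable_itv.
Qed.

Lemma lebesgue_unit_itv : lebesgue_measure (`[0, 1]%classic : set R) = 1%E.
Proof. by rewrite lebesgue_measure_itv/= lte_fin ltr01 sube0. Qed.

Lemma lebesgue_off_grid n d : 0 <= d ->
  ((1 - n%:R * (2 * d))%:E <= lebesgue_measure (off_grid n d))%E.
Proof.
move=> d0.
pose V i : set R := `](i.+1%:R / n%:R - d), (i.+1%:R / n%:R + d)[%classic.
have mV i : measurable (V i) by exact: measurable_itv.
have mG := measurable_off_grid n d; move: mG; rewrite /off_grid.
rewrite -/(\big[setU/set0]_(i < n) V i); set U := \big[setU/set0]_(i < n) V i => mG.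
have mU : measurable U by exact: bigsetU_measurable.
have muU : (lebesgue_measure U <= (n%:R * (2 * d))%:E)%E.
  apply: (le_trans (Boole_inequality lebesgue_measure (fun i _ => mV i))).
  rewrite (eq_bigr (fun=> (2 * d)%:E)) => [|i _].
    by rewrite sumEFin lee_fin sumr_const card_ord -(mulr_natl (2 * d) n).
  rewrite /V /= lebesgue_measure_itv/= lte_fin -EFinD; case: ltP => h; congr EFin; lra.
rewrite EFinB leeBlDr//; apply: (@le_trans _ _ (lebesgue_measure (off_grid n d `|` U))).
  rewrite -lebesgue_unit_itv; apply: le_measure; rewrite ?inE//.
    by apply: measurableU => //.
  by move=> x xI; have [Ux|Ux] := pselect (U x); [right | left].
by rewrite (le_trans (measureU2 _ _ _))// leeD2l.
Qed.

(** Take k = floor(nx). The last clause says that the steps switched on at [x] are exactly the first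
    [k]. *)
Lemma grid_index n (x : R) : (0 < n)%N -> 0 <= x <= 1 ->
  exists k : nat, [/\ (k <= n)%N, `|x - k%:R / n%:R| <= n%:R^-1 &
    forall i : nat, (i.+1%:R / n%:R <= x) = (i < k)%N].
Proof.
move=> n0 /andP[x0 x1]; have n0' : 0 < n%:R :> R by rewrite ltr0n.
exists (Num.truncn (x * n%:R)).
have /andP[k1 k2] : (Num.truncn (x * n%:R))%:R <= x * n%:R < (Num.truncn (x * n%:R)).+1%:R.
  by apply: truncn_itv; rewrite mulr_ge0// ltW.
split.
- rewrite -(ler_nat R) (le_trans k1)// -[leRHS]mul1r ler_wpM2r// ltW.
- move: k2; rewrite -natr1 => k2.
  rewrite -(ler_pM2r n0') mulVf ?gt_eqF// -[X in _ * X <= _](gtr0_norm n0') -normrM mulrBl divfK ?gt_eqF//.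
  by rewrite ger0_norm; lra.
- move=> i; rewrite ler_pdivrMr//; apply/idP/idP => h.
    by rewrite -ltnS -(ltr_nat R) (le_lt_trans h).
  by rewrite (le_trans _ k1)// ler_nat.
Qed.

Lemma sum_indicator (V : pzRingType) n k (F : nat -> V) : (k <= n)%N ->
  \sum_(i < n) F i * (i < k)%N%:R = \sum_(i < k) F i.
Proof.
move=> kn; rewrite (big_ord_widen n F kn) [RHS]big_mkcond/=.
by apply: eq_bigr => i _; case: ifP; rewrite ?mulr1 ?mulr0.
Qed.

Lemma grid_parameters (eps : R) : 0 < eps ->
  exists n d, [/\ (0 < n)%N, n%:R^-1 <= eps / 2, 0 < d, d <= 1 &
    n%:R * (2 * d) <= eps].
Proof.
move=> e0; exists (Num.truncn (2 / eps)).+1; set n := (Num.truncn _).+1.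
have n0 : 0 < n%:R :> R by rewrite ltr0n.
(* The [n] removed intervals of length 2d then have total length at most [eps]; the cap at 1 meets
   the requirement of the step approximations. *)
exists (Num.min 1 (eps / (2 * n%:R))); split => //.
- rewrite -[eps / 2]invf_div lef_pV2 ?posrE ?divr_gt0//.
  exact/ltW/truncnS_gt.
- by rewrite lt_min ltr01 divr_gt0// mulr_gt0.
- by rewrite ge_min lexx.
- apply: (@le_trans _ _ (n%:R * (2 * (eps / (2 * n%:R))))).
    by rewrite ler_wpM2l ?ler0n// ler_wpM2l// ge_min lexx orbT.
  by rewrite le_eqVlt; apply/orP; left; apply/eqP; field; rewrite gt_eqF.
Qed.

Lemma lebesgue_sublevel (p : {poly {poly R}}) (eps : R) (A : set (R * R)) :
  measurable A -> A `<=` unit_square ->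
  (forall z, A z -> `|eval2 p z| <= eps) ->
  (lebesgue_measure2 A <= lebesgue_measure2 (sublevel_set (eval2 p) eps))%E.
Proof.
move=> mA Asq Ale; apply: le_measure; rewrite ?inE//.
- have -> : sublevel_set (eval2 p) eps =
      unit_square `&` (eval2 p @^-1` `[- eps, eps]%classic).
    by apply/seteqP; split => z /= [zs ze]; split => //;
      move: ze; rewrite in_itv/= ler_norml.
  apply: measurableI; first by apply: measurableX; exact: measurable_itv.
  rewrite -[X in measurable X]setTI.
  by apply: measurable_eval2 => //; exact: measurable_itv.
- by move=> z Az; split; [exact: Asq | exact: Ale].
Qed.

End Grid.

(** * Gluing the local solutions *)

Section SmallSolutions.
Context {R : realType}.

(** [swap] places the grid on the t-axis (heat) rather than the x-axis (Laplacian), so that one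
    measure computation serves both operators. *)
Lemma sublevel_of_grid (swap : bool) (p : {poly {poly R}}) n d eps :
  0 <= d -> n%:R * (2 * d) <= eps ->
  (forall x t : R, 0 <= x <= 1 -> 0 <= t <= 1 ->
     (forall i : 'I_n, d <= `|(if swap then t else x) - i.+1%:R / n%:R|) ->
     `|eval2 p (x, t)| <= eps) ->
  ((1 - eps)%:E <= lebesgue_measure2 (sublevel_set (eval2 p) eps))%E.
Proof.
move=> d0 nd ple.
pose A : set (R * R) :=
  if swap then `[0, 1]%classic `*` off_grid n d else off_grid n d `*` `[0, 1]%classic.
have mI : measurable (`[0, 1]%classic : set R) by exact: measurable_itv.
have mG := @measurable_off_grid R n d.
have mA : measurable A by rewrite /A; case: (swap); exact: measurableX.
have AP x t : A (x, t) -> [/\ 0 <= x <= 1, 0 <= t <= 1 &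
    forall i : 'I_n, d <= `|(if swap then t else x) - i.+1%:R / n%:R|].
  rewrite /A; case: (swap) => -[/= h1 h2].
    by have [tI tg] := off_gridP h2; move: h1; rewrite in_itv/=.
  by have [xI xg] := off_gridP h1; move: h2; rewrite in_itv/=.
have muA : lebesgue_measure2 A = lebesgue_measure (off_grid n d).
  rewrite /A /lebesgue_measure2; case: (swap).
    rewrite product_measure1E// -[RHS]mul1e; congr (_ * _)%E.
    exact: lebesgue_unit_itv.
  rewrite product_measure1E// -[RHS]mule1; congr (_ * _)%E.
  exact: lebesgue_unit_itv.
apply: le_trans (lebesgue_sublevel mA _ _).
- by rewrite muA (le_trans _ (lebesgue_off_grid n d0))// lee_fin; lra.
- move=> [x t] /AP[xI tI _].
  by split; rewrite /= in_itv/=; [exact: xI | exact: tI].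
- by move=> [x t] /AP[xI tI xg]; exact: ple.
Qed.

(** The i-th summand is the jump from (z - i/n)^2 / 2 to (z - (i+1)/n)^2 / 2; the first [k] jumps
    telescope to (z - k/n)^2 / 2 - z^2 / 2. *)
Lemma grid_quadratic (C : numFieldType) n k (z : C) : (k <= n)%N ->
  \sum_(i < n) (- n%:R^-1 * z + i.*2.+1%:R / (2 * n%:R ^+ 2)) * (i < k)%N%:R =
    - (k%:R / n%:R) * z + k%:R ^+ 2 / (2 * n%:R ^+ 2).
Proof.
move=> kn; rewrite (sum_indicator (fun i => - n%:R^-1 * z + i.*2.+1%:R / (2 * n%:R ^+ 2)) kn).
elim: k {kn} => [|k IH]; first by rewrite big_ord0 expr0n/= !mul0r oppr0 mul0r addr0.
rewrite big_ord_recr/= IH -(natr1 k) -(natr1 k.*2) -muln2 natrM.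
set a := n%:R^-1; set b := (2 * _)^-1; ring.
Qed.

Lemma exists_small_laplacian1 (eps : R) : 0 < eps ->
  exists u : R * R -> R,
    [/\ smooth_on_square u,
        forall z, unit_square z -> laplacian u z = 1
      & ((1 - eps)%:E <= lebesgue_measure2 (sublevel_set u eps))%E].
Proof.
move=> e0; have [n [d [n0 ne d0 d1 nd]]] := grid_parameters e0.
have n0' : 0 < n%:R :> R by rewrite ltr0n.
(* The [n] affine jumps have modulus at most 3/n on the square, so errors of eps / 6 add up to eps /
   2. *)
have e6 : 0 < eps / 6 by lra.
have /choice[P PP] : forall i : 'I_n, exists P : {poly R[i]}, forall z,
    off_strip (i.+1%:R / n%:R) d z ->
    normc (P.[z] - (i.+1%:R / n%:R <= complex.Re z)%R%:R) <= eps / 6.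
  by move=> i; apply: complex_step => //; rewrite ler_pdivrMr// mul1r ler_nat.
pose l i : {poly R[i]} := (- n%:R^-1)%:P * 'X + (i.*2.+1%:R / (2 * n%:R ^+ 2))%:P.
have [a [b [ab ba gab]]] := complex_poly_parts (\sum_(i < n) l i * P i).
(* x^2 / 2 is the local solution at the node 0, and [a], the real part of the smoothed jumps, is
   harmonic. *)
pose p : {poly {poly R}} := 2^-1%:P%:P * 'X^2 + a.
exists (eval2 p); split; first exact: smooth_eval2.
- move=> z _; rewrite laplacian_eval2.
  have -> : p^`()^`() + deriv2 (deriv2 p) = 1.
    rewrite /p !derivD ab deriv_deriv2 derivM derivC mul0r add0r derivXn/=.
    rewrite derivM derivC mul0r add0r derivMn derivX deriv2D deriv2M deriv2C.
    rewrite derivC polyC0 mul0r add0r deriv2Xn mulr0 add0r ba deriv2N.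
    rewrite -addrA subrr addr0 mulrnAr mulr1 -polyCMn -polyCMn.
    by rewrite -(mulr_natr 2^-1 2) mulVf// pnatr_eq0.
  by rewrite /eval2 !hornerE.
apply: (sublevel_of_grid (swap := false) (ltW d0) nd) => x t xI tI xg.
have [k [kn xk ik]] := grid_index n0 xI.
set z := (x +i* t)%C.
(* Replacing every [P i] by its limit 0 or 1 yields the local solution of the current cell; the
   remainder is the approximation error. *)
have ple : eval2 p (x, t) = (x - k%:R / n%:R) ^+ 2 / 2 +
    complex.Re (\sum_(i < n) (l i).[z] * ((P i).[z] - (i < k)%N%:R)).
  rewrite /p eval2D eval2M eval2C hornerC /eval2 hornerXn -polyC_exp hornerC -/(eval2 a _).
  have := congr1 (@complex.Re R) (gab (x, t)); rewrite -/z /= => <-.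
  rewrite horner_sum (eq_bigr _ (fun (i : 'I_n) _ => hornerM (l i) (P i) z)).
  under [in RHS]eq_bigr do rewrite mulrBr.
  have lE i : (l i).[z] = - n%:R^-1 * z + i.*2.+1%:R / (2 * n%:R ^+ 2).
    by rewrite /l hornerD hornerM !hornerC hornerX.
  have -> : \sum_(i < n) ((l i).[z] * (P i).[z] - (l i).[z] * (i < k)%N%:R) =
      \sum_(i < n) (l i).[z] * (P i).[z]
      - (- (k%:R / n%:R) * z + k%:R ^+ 2 / (2 * n%:R ^+ 2)).
    rewrite sumrB -(grid_quadratic z kn); congr (_ - _).
    by apply: eq_bigr => i _; rewrite lE.
  have -> : - (k%:R / n%:R) * z + k%:R ^+ 2 / (2 * n%:R ^+ 2) =
      (- (k%:R / n%:R))%:C%C * z + (k%:R ^+ 2 / (2 * n%:R ^+ 2))%:C%C.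
    by rewrite !(rmorphN, rmorphM, fmorphV, rmorphXn, rmorph_nat).
  rewrite raddfB/= mul0r subr0.
  by field; rewrite gt_eqF.
have lz (i : 'I_n) : normc (l i).[z] <= 3 / n%:R.
  have zle : normc z <= 2 by exact: normc_unit_square.
  have -> : (l i).[z] = (- n%:R^-1)%:C%C * z + (i.*2.+1%:R / (2 * n%:R ^+ 2))%:C%C.
    rewrite /l hornerD hornerM !hornerC hornerX.
    by rewrite !(rmorphN, rmorphM, fmorphV, rmorphXn, rmorph_nat).
  have i2 : i.*2.+1%:R / (2 * n%:R ^+ 2) <= n%:R^-1 :> R.
    rewrite ler_pdivrMr ?mulr_gt0 ?exprn_gt0//.
    have -> : n%:R^-1 * (2 * n%:R ^+ 2) = (2 * n)%N%:R :> R.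
      by rewrite natrM; field; rewrite gt_eqF.
    by rewrite ler_nat; have := ltn_ord i; clear; lia.
  rewrite (le_trans (normcD _ _))// normcM !normc_real normrN.
  rewrite gtr0_norm ?invr_gt0// ger0_norm; last by rewrite divr_ge0// mulr_ge0// exprn_ge0.
  have : n%:R^-1 * normc z <= n%:R^-1 * 2 by rewrite ler_wpM2l// invr_ge0 ltW.
  lra.
have Pz (i : 'I_n) : normc ((P i).[z] - (i < k)%N%:R) <= eps / 6.
  rewrite -ik; apply: PP; split => //=; exact: xg.
rewrite ple (le_trans (ler_normD _ _))// [leRHS]splitr lerD//.
  (* From w <= 1/n <= 1 and 1/n <= eps / 2, the local solution w^2 / 2 is at most eps / 2. *)
  have n1 : n%:R^-1 <= 1 :> R by rewrite invf_le1// ler1n.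
  rewrite normrM normrX [`|2^-1|]ger0_norm; last by rewrite invr_ge0.
  have := normr_ge0 (x - k%:R / n%:R).
  move: xk ne n1; set w := `|_|; set v := n%:R^-1; nra.
apply: (le_trans (Re_le_normc _)); apply: (le_trans (normc_sum _)).
apply: (@le_trans _ _ (\sum_(i < n) 3 / n%:R * (eps / 6))).
  by apply: ler_sum => i _; rewrite normcM ler_pM ?normc_ge0.
rewrite sumr_const card_ord -mulr_natl le_eqVlt; apply/orP; left; apply/eqP.
by field; rewrite gt_eqF.
Qed.

Lemma exists_small_heat1 (eps : R) : 0 < eps ->
  exists u : R * R -> R,
    [/\ smooth_on_square u,
        forall z, unit_square z -> heat_op u z = 1
      & ((1 - eps)%:E <= lebesgue_measure2 (sublevel_set u eps))%E].
Proof.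
move=> e0; have [n [d [n0 ne d0 d1 nd]]] := grid_parameters e0.
have n0' : 0 < n%:R :> R by rewrite ltr0n.
have e2 : 0 < eps / 2 by lra.
have /choice[f ff] : forall i : 'I_n, exists f : {poly R}, forall x t : R,
    0 <= x <= 1 -> 0 <= t <= 1 -> d <= `|t - i.+1%:R / n%:R| ->
    `|eval2 (caloric f) (x, t) - (i.+1%:R / n%:R <= t)%R%:R| <= eps / 2.
  move=> i; apply: caloric_step => //; rewrite divr_ge0//=.
  by rewrite ler_pdivrMr// mul1r ler_nat.
(* Consecutive local solutions -(t - k/n) differ by the constant 1/n, so each caloric step enters
   with that weight. *)
pose p : {poly {poly R}} := - 'X%:P + \sum_(i < n) n%:R^-1%:P%:P * caloric (f i).
exists (eval2 p); split; first exact: smooth_eval2.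
- move=> z _; rewrite heat_op_eval2.
  have -> : p^`()^`() - deriv2 p = 1.
    rewrite /p; set S := \sum_(i < n) _.
    have hS : S^`()^`() = deriv2 S.
      rewrite /S /deriv2 !raddf_sum/=; apply: eq_bigr => i _.
      rewrite derivM derivC mul0r add0r derivM derivC mul0r add0r caloricP.
      by rewrite -!/(deriv2 _) deriv2M deriv2C derivC polyC0 mul0r add0r.
    rewrite derivD derivN derivC oppr0 add0r hS deriv2D deriv2N deriv2C derivX.
    by rewrite polyC1 opprD opprK addrCA subrr addr0.
  by rewrite /eval2 !hornerE.
apply: (sublevel_of_grid (swap := true) (ltW d0) nd) => x t xI tI tg.
have [k [kn tk ik]] := grid_index n0 tI.
have ple : eval2 p (x, t) = - (t - k%:R / n%:R) +
    \sum_(i < n) n%:R^-1 * (eval2 (caloric (f i)) (x, t) - (i < k)%N%:R).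
  under eq_bigr do rewrite mulrBr.
  rewrite sumrB (sum_indicator (fun=> n%:R^-1) kn) sumr_const card_ord -mulr_natl.
  rewrite /p eval2D eval2_sum eval2N eval2C hornerX/=.
  under eq_bigr do rewrite eval2M eval2C hornerC.
  ring.
rewrite ple (le_trans (ler_normD _ _))// normrN [leRHS]splitr lerD//.
  exact: le_trans ne.
rewrite (le_trans (ler_norm_sum _ _ _))//.
apply: (@le_trans _ _ (\sum_(i < n) n%:R^-1 * (eps / 2))).
  apply: ler_sum => i _; rewrite normrM gtr0_norm ?invr_gt0// ler_wpM2l ?invr_ge0 ?(ltW n0')//.
  by rewrite -ik; apply: ff => //; exact: tg.
by rewrite sumr_const card_ord -mulrnAl -mulr_natr mulVf ?gt_eqF// mul1r.
Qed.

End SmallSolutions.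

Theorem proposition3p1 (R : realType) :
  (forall eps : R, 0 < eps ->
     exists u : R * R -> R,
       [/\ smooth_on_square u,
           forall z, unit_square z -> laplacian u z = 1
         & ((1 - eps)%:E <= lebesgue_measure2 (sublevel_set u eps))%E])
  /\
  (forall eps : R, 0 < eps ->
     exists u : R * R -> R,
       [/\ smooth_on_square u,
           forall z, unit_square z -> heat_op u z = 1
         & ((1 - eps)%:E <= lebesgue_measure2 (sublevel_set u eps))%E]).
Proof. by split=> eps; [exact: exists_small_laplacian1 | exact: exists_small_heat1]. Qed.
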